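(* Let $d\ge 1$ be an integer, and let $\varepsilon>0$ and $C>0$ be fixed. Let $q=p^{\ell}$ range over powers ($\ell\ge 1$) of primes $p\ge 3$, let $\alpha,\beta\in\mathbb{Z}_q^{\times}$ be units, and let $E\subset\mathbb{Z}_q^d$ satisfy $$|E|\ge C\,q^{\frac{d(2\ell-1)}{2\ell}+\frac{1}{2\ell}+\varepsilon}.$$ Then $$|\Pi_{\alpha,\beta}(E)|=\frac{|E|^3}{q^2}\,(1+o(1)),$$ where $o(1)$ tends to $0$ as $q\to\infty$, uniformly in $E,\alpha,\beta$: for every $\delta>0$ there is $q_0=q_0(d,\varepsilon,C,\delta)$ such that for all such $q\ge q_0$ and all such $E,\alpha,\beta$, $\bigl|\,|\Pi_{\alpha,\beta}(E)|-|E|^3/q^2\,\bigr|\le\delta\,|E|^3/q^2$. In particular, when $d=2$, there is a constant $c>0$ depending only on $\varepsilon$ and $C$ such that every $E\subset\mathbb{Z}_q^2$ satisfying $|E|\ge C\,q^{\frac{2(2\ell-1)}{2\ell}+\frac{1}{2\ell}+\varepsilon}$ satisfies $|\Pi_{\alpha,\beta}(E)|\le c\,|E|^2$ for all units $\alpha,\beta\in\mathbb{Z}_q^\times$.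
   Context: $\mathbb{Z}_q$ is the ring of integers modulo $q$, $\mathbb{Z}_q^{\times}$ is its group of units, $\mathbb{Z}_q^d$ is the free module of rank $d$ over $\mathbb{Z}_q$, and for $x,y\in\mathbb{Z}_q^d$, $x\cdot y=\sum_{i=1}^d x_iy_i$. For $E\subset\mathbb{Z}_q^d$ and $\alpha,\beta\in\mathbb{Z}_q$, $$\Pi_{\alpha,\beta}(E)=\{(x,y,z)\in E\times E\times E : x\cdot y=\alpha,\ x\cdot z=\beta\}.$$ *)

(* Defs.v *)
From mathcomp Require Import all_boot all_order all_algebra.
From mathcomp Require Import reals exp.

Set Implicit Arguments.
Unset Strict Implicit.
Unset Printing Implicit Defensive.

Import Order.TTheory GRing.Theory Num.Theory.
Local Open Scope ring_scope.

(* ['Z_q] is the ring of integers modulo q only for 1 < q; it is used here at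
   q = p ^ l with p >= 3 prime and l >= 1. *)

Definition dotp (q d : nat) (x y : 'rV['Z_q]_d) : 'Z_q :=
  \sum_(i < d) x 0 i * y 0 i.

Definition Pi (q d : nat) (alpha beta : 'Z_q) (E : {set 'rV['Z_q]_d}) :
    {set 'rV['Z_q]_d * 'rV['Z_q]_d * 'rV['Z_q]_d} :=
  [set t | let: (x, y, z) := t in
    [&& x \in E, y \in E, z \in E, dotp x y == alpha & dotp x z == beta]].

Definition size_exponent (R : realType) (d l : nat) (eps : R) : R :=
  d%:R * (2 * l%:R - 1) / (2 * l%:R) + 1 / (2 * l%:R) + eps.

(* Main.v *)
(* Write q = p^l and, for x in Z_q^d, N_alpha(x) = #{y in E : x.y = alpha}, so that
   |Pi| = sum_{x in E} N_alpha(x) N_beta(x). The theorem follows from the second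
   moment bound, over all x in Z_q^d,
     sum_x (N_alpha(x) - |E|/q)^2 <= 4 |E| (q^2/p)^(d-1),   d >= 2,
   since the hypothesis says exactly |E|^2 >= C^2 q^(2 eps) q^2 (q^2/p)^(d-1).
   No characters are needed. Expanding the square, one counts, for y, y' in E, the x
   with x.y = x.y' = alpha. If p^m is the additive order of some coordinate of
   y' - y, the map x |-> (x.y, x.(y' - y)) has an image of at least q p^m elements as
   soon as there is a solution x0 (whose multiples map to all (t alpha, 0)), so there
   are at most q^(d-1) / p^m solutions; and at most p^(m d) vectors y' - y are killed
   by p^m, which makes the sum over m < l a geometric one. *)

Require Import Defs.
From mathcomp Require Import all_boot all_order all_algebra.
From mathcomp Require Import reals exp.
From mathcomp Require Import ring lra.

Set Implicit Arguments.
Unset Strict Implicit.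
Unset Printing Implicit Defensive.

Import Order.TTheory GRing.Theory Num.Theory.
Local Open Scope ring_scope.

(** * Additive orders modulo a prime power, and linearity of the dot product *)

Lemma mulrn_Zp_eq0 (q : nat) (a : 'Z_q) (n : nat) :
  (1 < q)%N -> (a *+ n == 0) = (q %| a * n)%N.
Proof. by move=> q1; rewrite Zp_mulrn -val_eqE /= [X in (_ %% X)%N]Zp_cast. Qed.

(** If [r < r'], write [r' - r = n' * p ^ v] with [n'] prime to [p]. Then [v < m], and cancelling
    [n'] modulo [p ^ l] leaves [a *+ p ^ v = 0], which is excluded. *)
Lemma mulrn_Zp_inj (p l m r r' : nat) (a : 'Z_(p ^ l)) :
  prime p -> (0 < l)%N -> (forall k, (k < m)%N -> a *+ p ^ k != 0) ->
  (r < p ^ m)%N -> (r' < p ^ m)%N -> a *+ r = a *+ r' -> r = r'.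
Proof.
move=> pp l0 Ha; wlog le_rr : r r' / (r <= r')%N.
  move=> W rm r'm E; have [/W|/ltnW/W] := leqP r r'; first exact.
  by move=> W'; symmetry; apply: W'.
move=> rm r'm E; apply/eqP; rewrite eqn_leq le_rr leqNgt /= -subn_gt0.
apply/negP => n0.
have q1 : (1 < p ^ l)%N by rewrite -(exp1n l) ltn_exp2r // prime_gt1.
have E0 : a *+ (r' - r) == 0 by rewrite mulrnBr // E subrr.
have [n' cp] := pfactor_coprime pp n0; move: (logn _ _) => v En.
have vm : (v < m)%N.
  rewrite -(ltn_exp2l _ _ (prime_gt1 pp)); apply: leq_ltn_trans r'm.
  apply: leq_trans (leq_subr r r'); rewrite En leq_pmull //.
  by move: n0; rewrite En muln_gt0 => /andP[].
move: E0; rewrite mulrn_Zp_eq0 // En mulnA mulnAC Gauss_dvdl ?coprimeXl //.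
by rewrite -mulrn_Zp_eq0 // (negPf (Ha _ vm)).
Qed.

Lemma dotpDl (q d : nat) (x x' y : 'rV['Z_q]_d) :
  dotp (x + x') y = dotp x y + dotp x' y.
Proof. by rewrite -big_split; apply: eq_bigr => i _; rewrite mxE mulrDl. Qed.

Lemma dotpZl (q d : nat) (c : 'Z_q) (x y : 'rV['Z_q]_d) :
  dotp (c *: x) y = c * dotp x y.
Proof. by rewrite mulr_sumr; apply: eq_bigr => i _; rewrite mxE mulrA. Qed.

Lemma dotpBr (q d : nat) (x y y' : 'rV['Z_q]_d) :
  dotp x (y - y') = dotp x y - dotp x y'.
Proof. by rewrite -sumrB; apply: eq_bigr => i _; rewrite !mxE mulrBr. Qed.

Lemma dotp_delta (q d : nat) (i : 'I_d) (y : 'rV['Z_q]_d) :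
  dotp (delta_mx 0 i) y = y 0 i.
Proof.
rewrite /dotp (bigD1 i) //= mxE !eqxx mul1r big1 ?addr0 // => j ji.
by rewrite mxE eqxx (negPf ji) mul0r.
Qed.

(** * Counting the common solutions of two dot product equations *)

Lemma card_Zmod (q : nat) : (1 < q)%N -> #|'Z_q| = q.
Proof. by move=> q1; rewrite card_ord Zp_cast. Qed.

Lemma card_rVZp (q d : nat) : (1 < q)%N -> #|{: 'rV['Z_q]_d}| = (q ^ d)%N.
Proof. by move=> q1; rewrite card_mx card_Zmod // mul1n. Qed.

(* The map (x, t, r) |-> x + t x0 + r e_i, for one solution x0, is injective. *)
Lemma card_dotp_pair (p l d m : nat) (alpha : 'Z_(p ^ l)) (i : 'I_d)
    (y y' : 'rV['Z_(p ^ l)]_d) :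
  prime p -> (0 < l)%N -> alpha \is a GRing.unit ->
  (forall k, (k < m)%N -> (y' - y) 0 i *+ p ^ k != 0) ->
  (#|[set x | (dotp x y == alpha) && (dotp x y' == alpha)]| * p ^ l * p ^ m
     <= (p ^ l) ^ d)%N.
Proof.
move=> pp l0 ua Hm; set S := [set x | _].
have q1 : (1 < p ^ l)%N by rewrite -(exp1n l) ltn_exp2r // prime_gt1.
have [->|[x0]] := set_0Vmem S; first by rewrite cards0.
rewrite inE => /andP[/eqP x0y /eqP x0y'].
pose f (u : 'rV['Z_(p ^ l)]_d * 'Z_(p ^ l) * 'I_(p ^ m)) :=
  u.1.1 + u.1.2 *: x0 + (u.2%:R : 'Z_(p ^ l)) *: delta_mx 0 i.
pose D := setX (setX S [set: 'Z_(p ^ l)]) [set: 'I_(p ^ m)].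
have <- : #|D| = (#|S| * p ^ l * p ^ m)%N.
  by rewrite !cardsX !cardsT card_Zmod // card_ord.
rewrite -(card_rVZp d q1) -(@card_in_imset _ _ f); first exact: max_card.
(* Pairing with [y' - y] kills both [x] and [x0], so it recovers [r]; pairing with [y] then recovers
   [t] because [alpha] is a unit. *)
have fE u : u \in D -> dotp (f u) y = alpha + u.1.2 * alpha + u.2%:R * y 0 i
    /\ dotp (f u) (y' - y) = (y' - y) 0 i *+ u.2.
  rewrite !inE => /andP[/andP[/andP[/eqP e1 /eqP e2] _] _].
  rewrite !dotpBr /f !dotpDl !dotpZl !dotp_delta e1 e2 x0y x0y' !mxE.
  by split=> //; rewrite -mulr_natl; ring.
move=> u u' uD u'D E.
have [e1 e2] := fE _ uD; have [e1' e2'] := fE _ u'D.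
have E2 : u.2 = u'.2.
  apply/val_inj; apply: (mulrn_Zp_inj pp l0 Hm (ltn_ord _) (ltn_ord _)).
  by rewrite -e2 -e2' E.
have E1 : u.1.2 = u'.1.2.
  apply: (mulIr ua); apply: (addrI alpha); apply: (addIr (u.2%:R * y 0 i)).
  by rewrite -e1 E2 -e1' E.
move: E; rewrite /f E1 E2 => /addIr/addIr E0.
by case: u u' E0 E1 E2 {uD u'D e1 e2 e1' e2'} => [[? ?] ?] [[? ?] ?] /= -> -> ->.
Qed.

(** * Torsion vectors and level sets of the dot product *)

(** For [q = p ^ l] and [m <= l], these are the vectors whose coordinates are all divisible by
    [p ^ (l - m)]. *)
Definition torsion (p q d m : nat) : {set 'rV['Z_q]_d} :=
  [set w | w *+ p ^ m == 0].

Lemma mulrn_rowE (q d n : nat) (w : 'rV['Z_q]_d) i : (w *+ n) 0 i = w 0 i *+ n.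
Proof. by elim: n => [|n IH]; rewrite ?mulr0n ?mxE // !mulrS mxE IH. Qed.

Lemma torsionP (p q d m : nat) (w : 'rV['Z_q]_d) :
  reflect (forall i, w 0 i *+ p ^ m = 0) (w \in torsion p q d m).
Proof.
rewrite inE; apply: (iffP eqP) => [E i|E]; first by rewrite -mulrn_rowE E mxE.
by apply/rowP=> i; rewrite mulrn_rowE E mxE.
Qed.

(** Each coordinate is [p ^ (l - m)] times a number below [p ^ m], so [f] maps onto the torsion
    vectors. *)
Lemma card_torsion (p l d m : nat) : prime p -> (0 < l)%N -> (m <= l)%N ->
  (#|torsion p (p ^ l) d m| <= p ^ (m * d))%N.
Proof.
move=> pp l0 ml.
have q1 : (1 < p ^ l)%N by rewrite -(exp1n l) ltn_exp2r // prime_gt1.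
pose f (w : 'rV['I_(p ^ m)]_d) : 'rV['Z_(p ^ l)]_d :=
  \row_i (p ^ (l - m) * w 0 i)%:R.
have -> : (p ^ (m * d) = #|[set: 'rV['I_(p ^ m)]_d]|)%N.
  by rewrite cardsT card_mx card_ord mul1n expnM.
apply: leq_trans (leq_imset_card f _); apply/subset_leq_card/subsetP => w.
move/torsionP => Hw.
have H i : (w 0%R i %/ p ^ (l - m) < p ^ m)%N.
  rewrite ltn_divLR ?expn_gt0 ?prime_gt0 // -expnD subnKC //.
  by rewrite -[X in (_ < X)%N](Zp_cast q1).
apply/imsetP; exists (\row_i Ordinal (H i)) => //.
apply/rowP=> i; rewrite !mxE /= mulnC divnK ?natr_Zp //.
move/eqP: (Hw i); rewrite mulrn_Zp_eq0 // -{1}(subnK ml) expnD.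
by rewrite dvdn_pmul2r // expn_gt0 prime_gt0.
Qed.

(** Outside the [p ^ k]-torsion some coordinate of [y] is a unit. Translations along that axis carry
    any level set into any other, so the [q] level sets have equal size. *)
Lemma card_dotp_level (p k d : nat) (alpha : 'Z_(p ^ k.+1))
    (y : 'rV['Z_(p ^ k.+1)]_d) :
  prime p -> y \notin torsion p (p ^ k.+1) d k ->
  (#|[set x | dotp x y == alpha]| * p ^ k.+1 = (p ^ k.+1) ^ d)%N.
Proof.
move=> pp yT.
have q1 : (1 < p ^ k.+1)%N by rewrite -(exp1n k.+1) ltn_exp2r // prime_gt1.
have [i ui] : exists i, y 0 i \is a GRing.unit.
  apply/existsP; apply: contraR yT; rewrite negb_exists => /forallP H.
  apply/torsionP => i; apply/eqP; rewrite mulrn_Zp_eq0 // [X in (X %| _)%N]expnS.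
  rewrite dvdn_pmul2r ?expn_gt0 ?prime_gt0 //.
  move: (H i); rewrite -{1}[y 0 i]natr_Zp unitZpE // coprime_pexpl //.
  by rewrite prime_coprime // negbK.
have transl a b : (#|[set x | dotp x y == a]| <= #|[set x | dotp x y == b]|)%N.
  pose g (x : 'rV['Z_(p ^ k.+1)]_d) := x + ((b - a) / y 0 i) *: delta_mx 0 i.
  rewrite -(@card_imset _ _ g) => [|x x' /addIr //].
  apply/subset_leq_card/subsetP => _ /imsetP[x + ->]; rewrite !inE => /eqP xa.
  by rewrite dotpDl dotpZl dotp_delta xa divrK // addrC subrK.
have -> : ((p ^ k.+1) ^ d = \sum_(a : 'Z_(p ^ k.+1)) #|[set x | dotp x y == a]|)%N.
  rewrite -card_rVZp // -sum1_card (partition_big (fun x => dotp x y) xpredT) //=.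
  by apply: eq_bigr => a _; rewrite -sum1dep_card.
rewrite (eq_bigr (fun=> #|[set x | dotp x y == alpha]|)) => [|a _].
  by rewrite sum_nat_const card_Zmod // mulnC.
by apply/eqP; rewrite eqn_leq !transl.
Qed.

(** A coordinate that survives [p ^ (m - 1)] survives every smaller power, so a single [i] serves
    all [k < m]. *)
Lemma not_torsion_coord (p q d m : nat) (w : 'rV['Z_q]_d.+1) :
  (forall k, (k < m)%N -> w \notin torsion p q d.+1 k) ->
  exists i, forall k, (k < m)%N -> w 0 i *+ p ^ k != 0.
Proof.
case: m => [|m] H; first by exists ord0.
have: ~~ [forall i, w 0 i *+ p ^ m == 0].
  by apply: contra (H m (ltnSn m)) => /'forall_eqP/torsionP.
rewrite negb_forall => /existsP[i wi]; exists i => k; rewrite ltnS => km.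
by apply: contra wi => /eqP E; rewrite -(subnKC km) expnD mulrnA E mul0rn.
Qed.

(** The term of the least [m] with [p ^ m] killing [y' - y] already suffices. Summing over all such
    [m] keeps the bound free of that minimum, so that it can be summed over [y'] by exchanging
    sums. *)
Lemma card_dotp_pair_le (R : realFieldType) (p l d : nat) (alpha : 'Z_(p ^ l))
    (y y' : 'rV['Z_(p ^ l)]_d.+1) :
  prime p -> (0 < l)%N -> alpha \is a GRing.unit ->
  #|[set x | (dotp x y == alpha) && (dotp x y' == alpha)]|%:R
    <= (p ^ l)%:R ^+ d.+1 / (p ^ l)%:R ^+ 2
       + \sum_(m < l | y' - y \in torsion p (p ^ l) d.+1 m)
           (p ^ l)%:R ^+ d.+1 / (p ^ l)%:R / p%:R ^+ m :> R.
Proof.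
move=> pp l0 ua; set S := [set x | _]; set Q : R := (p ^ l)%:R.
have p0 : 0 < p%:R :> R by rewrite ltr0n prime_gt0.
have Q0 : 0 < Q by rewrite ltr0n expn_gt0 prime_gt0.
have key m : (forall k, (k < m)%N -> y' - y \notin torsion p (p ^ l) d.+1 k) ->
    #|S|%:R <= Q ^+ d.+1 / Q / p%:R ^+ m.
  move=> /not_torsion_coord[i Hi].
  have := card_dotp_pair pp l0 ua Hi; rewrite -/S -(ler_nat R).
  rewrite 2!natrM [X in _ * X <= _]natrX [X in _ <= X]natrX -/Q.
  by rewrite !ler_pdivlMr ?exprn_gt0 // mulrAC.
have t0 (m : nat) : 0 <= Q ^+ d.+1 / Q / p%:R ^+ m.
  by rewrite !divr_ge0 ?exprn_ge0 // ltW.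
have [/existsP[m0 wm0]|] :=
  boolP [exists m : 'I_l, y' - y \in torsion p (p ^ l) d.+1 m].
  have exm : exists m, (m < l)%N && (y' - y \in torsion p (p ^ l) d.+1 m).
    by exists m0; rewrite ltn_ord.
  case: (ex_minnP exm) => m /andP[ml wm] minm.
  rewrite (bigD1 (Ordinal ml)) //=; apply: le_trans (key m _) _.
    move=> k km; apply/negP => wk; move: (minm k); rewrite wk (ltn_trans km ml).
    by move=> /(_ isT); rewrite leqNgt km.
  rewrite addrCA lerDl addr_ge0 ?sumr_ge0 //.
  by rewrite divr_ge0 ?exprn_ge0 // ltW.
(* No [m < l] kills the difference, so [key] applies at [m = l]; as [p ^ l = q], it gives the first
   term. *)
rewrite negb_exists => /forallP H; apply: le_trans (key l _) _.
  by move=> k kl; exact: (H (Ordinal kl)).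
by rewrite -natrX -/Q -mulrA -invfM -expr2 lerDl sumr_ge0.
Qed.

(** * Fibers, and double counting of their first and second moments *)

Definition fiber (q d : nat) (alpha : 'Z_q) (E : {set 'rV['Z_q]_d})
    (x : 'rV['Z_q]_d) : {set 'rV['Z_q]_d} :=
  [set z in E | dotp x z == alpha].

Lemma card_PiE (q d : nat) (alpha beta : 'Z_q) (E : {set 'rV['Z_q]_d}) :
  #|Pi alpha beta E| = (\sum_(x in E) #|fiber alpha E x| * #|fiber beta E x|)%N.
Proof.
rewrite (eq_bigr (fun x => #|setX (fiber alpha E x) (fiber beta E x)|)%N); last first.
  by move=> x _; rewrite cardsX.
rewrite -sum1_card (partition_big (fun t => t.1.1) (mem E)) /=; last first.
  by case=> [[x y] z]; rewrite inE => /and5P[].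
apply: eq_bigr => x xE; rewrite sum1dep_card.
rewrite -[RHS](@card_imset _ _ (fun u => (x, u.1, u.2))); last first.
  by case=> [? ?] [? ?] [-> ->].
apply: eq_card => -[[x' y] z]; rewrite !inE /=.
apply/idP/imsetP => [/andP[/and5P[_ yE zE ya zb] /eqP xx]|].
  by rewrite -xx; exists (y, z); rewrite // !inE /= yE zE ya zb.
case=> [[y' z']]; rewrite !inE /= => /andP[/andP[yE ya] /andP[zE zb]].
by case=> -> -> ->; rewrite xE yE ya zE zb eqxx.
Qed.

Lemma card_fiberE (q d : nat) (alpha : 'Z_q) (E : {set 'rV['Z_q]_d}) x :
  #|fiber alpha E x| = (\sum_(y in E) (dotp x y == alpha))%N.
Proof.
rewrite -sum1_card (eq_bigl (fun y => (y \in E) && (dotp x y == alpha))).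
  by rewrite big_mkcondr; apply: eq_bigr => y _; case: eqP.
by move=> y; rewrite inE.
Qed.

Lemma sum_card_fiber (q d : nat) (alpha : 'Z_q) (E : {set 'rV['Z_q]_d}) :
  (\sum_x #|fiber alpha E x| = \sum_(y in E) #|[set x | dotp x y == alpha]|)%N.
Proof.
under eq_bigr do rewrite card_fiberE.
rewrite exchange_big; apply: eq_bigr => y _.
by rewrite -sum1dep_card [RHS]big_mkcond; apply: eq_bigr => x _; case: eqP.
Qed.

Lemma sum_card_fiber_sqr (q d : nat) (alpha : 'Z_q) (E : {set 'rV['Z_q]_d}) :
  (\sum_x #|fiber alpha E x| ^ 2 = \sum_(y in E) \sum_(y' in E)
     #|[set x | (dotp x y == alpha) && (dotp x y' == alpha)]|)%N.
Proof.
under eq_bigr do rewrite card_fiberE -mulnn big_distrlr /=.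
rewrite exchange_big; apply: eq_bigr => y _.
rewrite exchange_big; apply: eq_bigr => y' _.
rewrite -sum1dep_card [RHS]big_mkcond; apply: eq_bigr => x _.
by do 2!case: eqP.
Qed.

(** * Second moment and variance bounds, and the passage to triples *)

Lemma geometric_sum_le (R : realFieldType) (a : R) (k : nat) :
  2 <= a -> \sum_(m < k.+1) a ^+ m <= 2 * a ^+ k.
Proof.
move=> a2; elim: k => [|k IH]; first by rewrite big_ord1 expr0; lra.
rewrite big_ord_recr /= exprS.
have : 2 * a ^+ k <= a * a ^+ k.
  by rewrite ler_wpM2r // exprn_ge0 //; lra.
by lra.
Qed.

(** For fixed [y], at most [p ^ (m * d.+2)] vectors [y'] carry the weight [Q ^+ d.+1 / p ^ m]. The
    sum over [m] is thus geometric of ratio [p ^ d.+1], and its top term [m = k] controls it up to a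
    factor 2. *)
Lemma sum_card_fiber_sqr_le (R : realFieldType) (p k d : nat)
    (alpha : 'Z_(p ^ k.+1)) (E : {set 'rV['Z_(p ^ k.+1)]_d.+2}) :
  prime p -> alpha \is a GRing.unit ->
  \sum_x #|fiber alpha E x|%:R ^+ 2
    <= #|E|%:R ^+ 2 * (p ^ k.+1)%:R ^+ d
       + 2 * #|E|%:R * ((p ^ k.+1)%:R * (p ^ k)%:R) ^+ d.+1 :> R.
Proof.
move=> pp ua; set Q : R := (p ^ k.+1)%:R.
have p0 : 0 < p%:R :> R by rewrite ltr0n prime_gt0.
have Q0 : 0 < Q by rewrite ltr0n expn_gt0 prime_gt0.
have -> : \sum_x #|fiber alpha E x|%:R ^+ 2
    = (\sum_x #|fiber alpha E x| ^ 2)%N%:R :> R.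
  by rewrite natr_sum; apply: eq_bigr => x _; rewrite natrX.
rewrite sum_card_fiber_sqr natr_sum.
suff H y : y \in E -> (\sum_(y' in E)
     #|[set x | (dotp x y == alpha) && (dotp x y' == alpha)]|)%:R
     <= #|E|%:R * Q ^+ d + 2 * (Q * (p ^ k)%:R) ^+ d.+1.
  apply: le_trans (ler_sum _ H) _; rewrite sumr_const -[X in X <= _]mulr_natl.
  by rewrite le_eqVlt; apply/orP; left; apply/eqP; ring.
move=> yE; rewrite natr_sum.
apply: le_trans (ler_sum _ (fun y' _ => card_dotp_pair_le R y y' pp (ltn0Sn k) ua)) _.
have EQ : Q ^+ d.+2 / Q ^+ 2 = Q ^+ d.
  by rewrite -addn2 exprD mulfK // expf_neq0 ?gt_eqF.
rewrite -/Q EQ big_split /= lerD //.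
  by rewrite sumr_const -[X in X <= _]mulr_natl.
rewrite (exchange_big_dep xpredT) //=.
have -> : (Q * (p ^ k)%:R) ^+ d.+1 = Q ^+ d.+1 * (p%:R ^+ d.+1) ^+ k.
  by rewrite exprMn natrX exprAC.
apply: (@le_trans _ _ (\sum_(m < k.+1) Q ^+ d.+1 * (p%:R ^+ d.+1) ^+ m)).
  apply: ler_sum => m _; rewrite sumr_const -[X in X <= _]mulr_natl.
  rewrite [Q ^+ d.+2]exprSr mulfK ?gt_eqF // mulrCA ler_wpM2l ?exprn_ge0 ?(ltW Q0) //.
  rewrite ler_pdivrMr ?exprn_gt0 // -exprM -exprD -natrX ler_nat.
  have -> : (d.+1 * m + m = m * d.+2)%N by rewrite [RHS]mulnC [RHS]mulSn addnC.
  apply: leq_trans (card_torsion d.+2 pp (ltn0Sn k) (ltnW (ltn_ord m))).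
  rewrite -(@card_imset _ _ (fun y' => y' - y)) => [|? ? /addIr //].
  by apply/subset_leq_card/subsetP => _ /imsetP[y' /andP[_ H] ->].
rewrite -mulr_sumr mulrCA ler_wpM2l ?exprn_ge0 ?(ltW Q0) // geometric_sum_le //.
rewrite -natrX ler_nat expnS (leq_trans (prime_gt1 pp)) // leq_pmulr //.
by rewrite expn_gt0 prime_gt0.
Qed.

Definition discrepancy (R : realFieldType) (q d : nat) (alpha : 'Z_q)
    (E : {set 'rV['Z_q]_d}) (x : 'rV['Z_q]_d) : R :=
  #|fiber alpha E x|%:R - #|E|%:R / q%:R.

Lemma sum_discrepancy_sqr_le (R : realFieldType) (p k d : nat)
    (alpha : 'Z_(p ^ k.+1)) (E : {set 'rV['Z_(p ^ k.+1)]_d.+2}) :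
  prime p -> alpha \is a GRing.unit ->
  \sum_x discrepancy R alpha E x ^+ 2
    <= 4 * #|E|%:R * ((p ^ k.+1)%:R * (p ^ k)%:R) ^+ d.+1.
Proof.
move=> pp ua; set Q : R := (p ^ k.+1)%:R; set e : R := #|E|%:R.
set P : R := (p ^ k)%:R.
have p2 : 2 <= p%:R :> R by rewrite ler_nat prime_gt1.
have P0 : 0 < P by rewrite ltr0n expn_gt0 prime_gt0.
have QE : Q = p%:R * P by rewrite /Q expnS natrM.
have Q0 : 0 < Q by rewrite ltr0n expn_gt0 prime_gt0.
have q1 : (1 < p ^ k.+1)%N by rewrite -(exp1n k.+1) ltn_exp2r // prime_gt1.
have e0 : 0 <= e by rewrite ler0n.
have -> : \sum_x discrepancy R alpha E x ^+ 2
    = \sum_x #|fiber alpha E x|%:R ^+ 2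
      - 2 * (e / Q) * \sum_x #|fiber alpha E x|%:R + e ^+ 2 * Q ^+ d.
  rewrite mulr_sumr -sumrB.
  have -> : e ^+ 2 * Q ^+ d = \sum_(x : 'rV['Z_(p ^ k.+1)]_d.+2) (e / Q) ^+ 2.
    rewrite sumr_const card_rVZp // -[RHS]mulr_natl natrX -/Q.
    by rewrite !exprS; field; rewrite gt_eqF.
  by rewrite -big_split; apply: eq_bigr => x _; rewrite /discrepancy /= -/e -/Q; ring.
(* The first moment enters the variance with a minus sign, so a lower bound is enough: the [y] in
   the [p ^ k]-torsion, at most [P ^+ d.+2] of them, are dropped, and every other [y] contributes
   exactly [Q ^+ d.+1]. *)
have mean : Q ^+ d.+1 * (e - P ^+ d.+2) <= \sum_x #|fiber alpha E x|%:R.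
  rewrite -natr_sum sum_card_fiber natr_sum.
  rewrite (bigID (mem (torsion p (p ^ k.+1) d.+2 k))) /=.
  rewrite -[X in X <= _]add0r lerD ?sumr_ge0 //.
  rewrite (eq_bigr (fun=> Q ^+ d.+1)) => [|y /andP[_ yT]]; last first.
    apply: (mulIf (lt0r_neq0 Q0)).
    by rewrite -natrM card_dotp_level // natrX -exprSr.
  rewrite sumr_const -mulr_natr ler_wpM2l ?exprn_ge0 ?(ltW Q0) // lerBlDr.
  rewrite -natrX -natrD ler_nat -expnM.
  apply: leq_trans (leq_add (leqnn _) (card_torsion d.+2 pp (ltn0Sn k) (leqnSn k))).
  rewrite -(cardsID (torsion p (p ^ k.+1) d.+2 k) E) addnC leq_add //.
    by apply/subset_leq_card/subsetP => y; rewrite inE andbC.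
  exact/subset_leq_card/subsetIr.
have sq := sum_card_fiber_sqr_le R E pp ua; rewrite -/Q -/e -/P in sq.
have QPd : 0 <= Q ^+ d * P ^+ d.+1 by rewrite mulr_ge0 ?exprn_ge0 ?ltW.
have mean' : 2 * (e / Q) * (Q ^+ d.+1 * (e - P ^+ d.+2))
    <= 2 * (e / Q) * \sum_x #|fiber alpha E x|%:R.
  by rewrite ler_wpM2l // mulr_ge0 // divr_ge0 // ltW.
have E1 : 2 * (e / Q) * (Q ^+ d.+1 * (e - P ^+ d.+2))
    = 2 * e ^+ 2 * Q ^+ d - 2 * e * (Q ^+ d * P ^+ d.+1) * P.
  by rewrite exprS [P ^+ d.+2]exprS; field; rewrite gt_eqF.
have E2 : (Q * P) ^+ d.+1 = Q * (Q ^+ d * P ^+ d.+1) by rewrite exprMn exprS; ring.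
move: sq mean' E1; rewrite E2; move: (Q ^+ d * P ^+ d.+1) QPd => z z0 sq mean' E1.
(* The multiples of [e ^+ 2 * Q ^+ d] cancel. What remains is [2 * e * z * Q] from the second moment
   and [2 * e * z * P] from the mean, whence the constant 4. *)
have : e * z * P <= e * z * Q.
  by rewrite ler_wpM2l ?mulr_ge0 // QE ler_peMl ?ltW //; lra.
by lra.
Qed.

(* AM-GM: [a |r| <= (t a^2 + r^2 / t) / 2], where a = |E| / q. *)
Lemma card_Pi_discrepancy (R : realFieldType) (q d : nat) (alpha beta : 'Z_q)
    (E : {set 'rV['Z_q]_d}) (kappa t : R) :
  let M := #|E|%:R ^+ 3 / q%:R ^+ 2 in
  0 < t ->
  \sum_x discrepancy R alpha E x ^+ 2 <= kappa * M ->
  \sum_x discrepancy R beta E x ^+ 2 <= kappa * M ->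
  `| #|Pi alpha beta E|%:R - M | <= (t + kappa / t + kappa) * M.
Proof.
move=> M t0 Va Vb; set e : R := #|E|%:R; set a := e / q%:R.
set r := discrepancy R alpha E; set s := discrepancy R beta E.
have ME : M = \sum_(x in E) a ^+ 2.
  by rewrite sumr_const -[RHS]mulr_natl -/e /a exprMn exprVn /M -/e; ring.
(* Expand [(a + r x) * (a + s x) - a ^+ 2]. *)
have -> : #|Pi alpha beta E|%:R - M
    = \sum_(x in E) (r x * s x + a * r x + a * s x).
  rewrite card_PiE natr_sum ME -sumrB; apply: eq_bigr => x _.
  by rewrite natrM /r /s /discrepancy -/e -/a; ring.
apply: le_trans (ler_norm_sum _ _ _) _.
have amgm x : `|r x * s x + a * r x + a * s x|
    <= 2^-1 * (1 + t^-1) * (r x ^+ 2 + s x ^+ 2) + t * a ^+ 2.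
  have h (u v : R) : `|u * v| <= 2^-1 * (u ^+ 2 + v ^+ 2).
    rewrite ler_norml; apply/andP; split; rewrite -subr_ge0.
      have -> : u * v - - (2^-1 * (u ^+ 2 + v ^+ 2)) = 2^-1 * (u + v) ^+ 2.
        by field.
      by rewrite mulr_ge0 ?sqr_ge0 // invr_ge0.
    have -> : 2^-1 * (u ^+ 2 + v ^+ 2) - u * v = 2^-1 * (u - v) ^+ 2 by field.
    by rewrite mulr_ge0 ?sqr_ge0 // invr_ge0.
  have ht (v : R) : `|a * v| <= 2^-1 * (t * a ^+ 2 + t^-1 * v ^+ 2).
    have -> : a * v = t^-1 * ((t * a) * v) by field; rewrite gt_eqF.
    have ti : 0 <= t^-1 by rewrite invr_ge0 ltW.
    rewrite normrM (ger0_norm ti).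
    have -> : 2^-1 * (t * a ^+ 2 + t^-1 * v ^+ 2)
        = t^-1 * (2^-1 * ((t * a) ^+ 2 + v ^+ 2)) by field; rewrite gt_eqF.
    by rewrite ler_wpM2l.
  apply: le_trans (ler_normD _ _) _; apply: le_trans (lerD (ler_normD _ _) (ht _)) _.
  apply: le_trans (lerD (lerD (h _ _) (ht _)) (lexx _)) _.
  by rewrite le_eqVlt; apply/orP; left; apply/eqP; field; rewrite gt_eqF.
apply: le_trans (ler_sum _ (fun x _ => amgm x)) _.
rewrite big_split /= -[X in X + _]mulr_sumr -[X in _ + X]mulr_sumr -ME big_split /=.
have sub (f : 'rV['Z_q]_d -> R) : \sum_(x in E) f x ^+ 2 <= \sum_x f x ^+ 2.
  by rewrite [X in _ <= X](bigID (mem E)) /= lerDl sumr_ge0 // => x _; exact: sqr_ge0.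
have -> : (t + kappa / t + kappa) * M
    = 2^-1 * (1 + t^-1) * (kappa * M + kappa * M) + t * M.
  by field; rewrite gt_eqF.
rewrite lerD2r ler_wpM2l //.
  by rewrite mulr_ge0 ?invr_ge0 // addr_ge0 // invr_ge0 ltW.
by rewrite lerD // (le_trans (sub _)).
Qed.

(** * The size hypothesis and the limit of large [q] *)

(** Compare exponents of [p]: with [l = k.+1] and [D = d.+2], the identity is
    [D (2l - 1) + 1 = 2l + (D - 1) (2l - 1)], plus [2 l eps] on both sides. *)
Lemma powR_size_exponent (R : realType) (p k d : nat) (eps : R) : (0 < p)%N ->
  ((p ^ k.+1)%:R `^ size_exponent d.+2 k.+1 eps) ^+ 2
    = (p ^ k.+1)%:R ^+ 2 * ((p ^ k.+1)%:R * (p ^ k)%:R) ^+ d.+1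
      * ((p ^ k.+1)%:R `^ eps) ^+ 2.
Proof.
move=> p0; have p0R : 0 < p%:R :> R by rewrite ltr0n.
have pE n : (p ^ n)%:R = p%:R `^ n%:R :> R by rewrite powR_mulrn ?ltW // natrX.
have powRX (x : R) n : (p%:R `^ x) ^+ n = p%:R `^ (x * n%:R).
  by rewrite -powR_mulrn ?powR_ge0 // powRrM.
have pD (x y : R) : p%:R `^ x * p%:R `^ y = p%:R `^ (x + y).
  by rewrite powRD // (gt_eqF p0R) implybT.
rewrite !pE -!powRrM pD !powRX !pD /size_exponent; congr (_ `^ _).
have k1 : k%:R + 1 != 0 :> R by rewrite natr1 pnatr_eq0.
by rewrite -!natr1; field.
Qed.

(** Squaring the size hypothesis trades the factor [(q * p ^ k) ^+ d.+1] of the variance bound for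
    [|E|^2 / q^2], with a saving of [(C * q^eps)^2]. *)
Lemma sum_discrepancy_sqr_large (R : realType) (eps C : R) (p k d : nat)
    (alpha : 'Z_(p ^ k.+1)) (E : {set 'rV['Z_(p ^ k.+1)]_d.+2}) :
  0 < C -> prime p -> alpha \is a GRing.unit ->
  C * (p ^ k.+1)%:R `^ size_exponent d.+2 k.+1 eps <= #|E|%:R ->
  \sum_x discrepancy R alpha E x ^+ 2
    <= 4 / (C * (p ^ k.+1)%:R `^ eps) ^+ 2
       * (#|E|%:R ^+ 3 / (p ^ k.+1)%:R ^+ 2).
Proof.
move=> C0 pp ua hE; apply: le_trans (sum_discrepancy_sqr_le R E pp ua) _.
have q0 : 0 < (p ^ k.+1)%:R :> R by rewrite ltr0n expn_gt0 prime_gt0.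
have qe0 : 0 < (p ^ k.+1)%:R `^ eps by rewrite powR_gt0.
have := hE; rewrite -(ler_pXn2r (ltn0Sn 1)) ?nnegrE ?ler0n //; last first.
  by rewrite mulr_ge0 ?powR_ge0 // ltW.
rewrite exprMn powR_size_exponent ?prime_gt0 //.
move: (_ `^ eps) qe0 => f f0.
move: (_ * (p ^ k)%:R) => z; move: (p ^ k.+1)%:R q0 => Q Q0.
move: #|E|%:R (ler0n R #|E|) => e e0 h.
have -> : 4 / (C * f) ^+ 2 * (e ^+ 3 / Q ^+ 2)
    = 4 * e * (e ^+ 2 / (C ^+ 2 * (Q ^+ 2 * f ^+ 2))).
  by field; rewrite !gt_eqF.
rewrite ler_wpM2l ?mulr_ge0 // ler_pdivlMr ?mulr_gt0 ?exprn_gt0 //.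
by apply: le_trans h; rewrite le_eqVlt; apply/orP; left; apply/eqP; ring.
Qed.

Lemma powR_nat_unbounded (R : realType) (eps B : R) : 0 < eps -> 0 <= B ->
  exists n0 : nat, forall n : nat, (n0 <= n)%N -> B <= n%:R `^ eps.
Proof.
move=> eps0 B0; exists (Num.bound (B `^ eps^-1)) => n hn.
have BE : (B `^ eps^-1) `^ eps = B by rewrite -powRrM mulVf ?gt_eqF ?powRr1.
rewrite -[X in X <= _]BE ge0_ler_powR ?nnegrE ?powR_ge0 ?ler0n ?(ltW eps0) //.
apply: ltW; apply: lt_le_trans (archi_boundP (powR_ge0 _ _)) _.
by rewrite ler_nat.
Qed.

Lemma card_Pi_asymptotic (R : realType) (eps C : R) : 0 < eps -> 0 < C ->
  forall d : nat, (1 <= d)%N -> forall delta : R, 0 < delta ->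
  exists q0 : nat,
  forall p l : nat, prime p -> (1 <= l)%N -> (q0 <= p ^ l)%N ->
  forall (alpha beta : 'Z_(p ^ l)) (E : {set 'rV['Z_(p ^ l)]_d}),
    alpha \is a GRing.unit -> beta \is a GRing.unit ->
    C * (p ^ l)%:R `^ size_exponent d l eps <= #|E|%:R ->
    `| #|Pi alpha beta E|%:R - #|E|%:R ^+ 3 / (p ^ l)%:R ^+ 2 |
      <= delta * (#|E|%:R ^+ 3 / (p ^ l)%:R ^+ 2).
Proof.
move=> eps0 C0 [//|[|d]] _ delta delta0.
  (* For d = 1 the exponent is 1 + eps, so no such E exists once C q^eps > 1. *)
  have [|q0 Hq0] := @powR_nat_unbounded R eps (2 / C) eps0.
    by rewrite divr_ge0 // ltW.
  exists q0 => p [//|k] pp _ /Hq0 hq alpha beta E _ _.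
  have q1 : (1 < p ^ k.+1)%N by rewrite -(exp1n k.+1) ltn_exp2r // prime_gt1.
  have Q0 : 0 < (p ^ k.+1)%:R :> R by rewrite ltr0n ltnW.
  have -> : size_exponent 1 k.+1 eps = 1 + eps.
    have k1 : k%:R + 1 != 0 :> R by rewrite natr1 pnatr_eq0.
    by rewrite /size_exponent -!natr1; field.
  have := max_card (mem E); rewrite card_rVZp // expn1 -(ler_nat R) => hE /le_trans/(_ hE).
  rewrite powRD; last by rewrite (gt_eqF Q0) implybT.
  rewrite powRr1 ?(ltW Q0) //.
  move: hq; rewrite ler_pdivrMr // => hq h.
  have := ler_wpM2l (ltW Q0) hq.
  by nra.
(* Each of the three terms [t], [kappa / t] and [kappa] of the error is then at most [delta / 3]. *)
pose t := delta / 3; pose kappa := Num.min (t ^+ 2) t.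
have t0 : 0 < t by rewrite divr_gt0.
have kappa0 : 0 < kappa by rewrite lt_min exprn_gt0.
(* For [F = C * q^eps >= B], both [F >= 1] and [F >= 4 / kappa] hold, so
   [4 / kappa <= F <= F ^+ 2]. *)
pose B := 1 + 4 / kappa.
have B1 : 1 <= B by rewrite lerDl divr_ge0 // ltW.
have [|q0 Hq0] := @powR_nat_unbounded R eps (B / C) eps0.
  by rewrite divr_ge0 ?(le_trans _ B1) // ltW.
exists q0 => p [//|k] pp _ /Hq0 hq alpha beta E ua ub hE.
have Va := sum_discrepancy_sqr_large C0 pp ua hE.
have Vb := sum_discrepancy_sqr_large C0 pp ub hE.
apply: le_trans (card_Pi_discrepancy t0 Va Vb) _.
rewrite ler_wpM2r ?divr_ge0 ?exprn_ge0 ?ler0n //.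
have kappa_le : 4 / (C * (p ^ k.+1)%:R `^ eps) ^+ 2 <= kappa.
  move: hq; rewrite ler_pdivrMr // mulrC; move: (C * _) => F BF.
  have F1 : 1 <= F by apply: le_trans BF.
  rewrite ler_pdivrMr ?exprn_gt0 ?(lt_le_trans ltr01) //.
  have : 4 / kappa <= F by apply: le_trans BF; rewrite lerDr.
  rewrite ler_pdivrMr // => h; apply: le_trans h _.
  by rewrite mulrC ler_wpM2l ?(ltW kappa0) // expr2 ler_peMl // (le_trans _ F1).
move: (4 / _) kappa_le => kap; rewrite le_min => /andP[k1 k2].
have k3 : kap / t <= t by rewrite ler_pdivrMr // -expr2.
by apply: le_trans (lerD (lerD (lexx t) k3) k2) _; rewrite /t; lra.
Qed.

Theorem theorem7 (R : realType) (eps C : R) (eps_gt0 : 0 < eps) (C_gt0 : 0 < C) :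
  (forall d : nat, (1 <= d)%N ->
   forall delta : R, 0 < delta ->
   exists q0 : nat,
   forall p l : nat, prime p -> (3 <= p)%N -> (1 <= l)%N -> (q0 <= p ^ l)%N ->
   forall (alpha beta : 'Z_(p ^ l)) (E : {set 'rV['Z_(p ^ l)]_d}),
     alpha \is a GRing.unit -> beta \is a GRing.unit ->
     C * (p ^ l)%:R `^ size_exponent d l eps <= #|E|%:R ->
     `| #|Pi alpha beta E|%:R - #|E|%:R ^+ 3 / (p ^ l)%:R ^+ 2 |
       <= delta * (#|E|%:R ^+ 3 / (p ^ l)%:R ^+ 2))
  /\
  (exists2 c : R, 0 < c &
   forall p l : nat, prime p -> (3 <= p)%N -> (1 <= l)%N ->
   forall E : {set 'rV['Z_(p ^ l)]_2},
     C * (p ^ l)%:R `^ size_exponent 2 l eps <= #|E|%:R ->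
   forall alpha beta : 'Z_(p ^ l),
     alpha \is a GRing.unit -> beta \is a GRing.unit ->
     #|Pi alpha beta E|%:R <= c * #|E|%:R ^+ 2).
Proof.
split.
  move=> d d1 delta delta0.
  have [q0 H] := card_Pi_asymptotic eps_gt0 C_gt0 d1 delta0.
  by exists q0 => p l pp _; exact: H.
have [q0 H] := card_Pi_asymptotic eps_gt0 C_gt0 (isT : (1 <= 2)%N) ltr01.
(* For [q >= q0], the asymptotic with [delta = 1] and [|E| <= q^2] give the constant 2. For
   [q < q0], the trivial bound [|E|^3] and [|E| <= q^2 <= q0^2] give the other summand. *)
exists (2 + q0%:R ^+ 2); first by rewrite ltr_wpDr ?exprn_ge0.
move=> p l pp _ l1 E hE alpha beta ua ub.
have q1 : (1 < p ^ l)%N by rewrite -(exp1n l) ltn_exp2r // prime_gt1.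
have Q0 : 0 < (p ^ l)%:R :> R by rewrite ltr0n ltnW.
have := max_card (mem E); rewrite card_rVZp // -(ler_nat R) natrX => eQ.
have e0 : 0 <= #|E|%:R :> R by rewrite ler0n.
rewrite mulrDl; have [hq|hq] := leqP q0 (p ^ l).
  apply: (@le_trans _ _ (2 * #|E|%:R ^+ 2)); last first.
    by rewrite lerDl mulr_ge0 ?exprn_ge0.
  have : #|E|%:R ^+ 3 / (p ^ l)%:R ^+ 2 <= #|E|%:R ^+ 2 :> R.
    by rewrite ler_pdivrMr ?exprn_gt0 // exprSr ler_wpM2l ?exprn_ge0.
  have := H p l pp l1 hq alpha beta E ua ub hE; rewrite mul1r ler_norml => /andP[_].
  by lra.
apply: (@le_trans _ _ (q0%:R ^+ 2 * #|E|%:R ^+ 2)); last first.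
  by rewrite lerDr mulr_ge0 ?exprn_ge0.
apply: (@le_trans _ _ (#|E|%:R * #|E|%:R ^+ 2)).
  rewrite -natrX -natrM ler_nat card_PiE -sum_nat_const leq_sum // => x _.
  by rewrite -mulnn leq_mul //; apply/subset_leq_card/subsetP => y; rewrite inE => /andP[].
rewrite ler_wpM2r ?exprn_ge0 // (le_trans eQ) // lerXn2r ?nnegrE ?ler0n //.
by rewrite ler_nat ltnW.
Qed.
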